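(* Let $t=0$, let $s\in\mathbb{C}$, and let $\mathcal{B}=\mathcal{Y}(\mathfrak g,\mathfrak g)\subset\mathcal{Y}(\mathfrak g)$, $\mathfrak g=\mathfrak{gl}(1|1)$, be the twisted Yangian of type II, i.e. the left coideal subalgebra generated by $E^\pm,H,H_2$ and $$\widetilde{\widetilde E}{}^\pm=\pm\frac12\Big([\widehat H_2,\widehat E^\pm]+\alpha\big(\pm t\,\widehat E^\pm+E^\pm\widehat H-\widehat E^\pm H\big)\Big),\qquad \widetilde{\widetilde H}=\{E^\pm,\widetilde{\widetilde E}{}^\mp\}.$$ Then $\mathcal{B}$ is a reflection algebra for a vector boundary: the intertwining equation $$(T_{-u}\otimes T_s)[\Delta(b)]\,K(u)=K(u)\,(T_u\otimes T_s)[\Delta(b)]\qquad\text{for all }b\in\mathcal{B}$$ determines a nonzero $4\times4$ matrix $K(u)\in\mathrm{End}(\mathcal V\otimes\mathcal W)$ (with entries in $\mathbb{C}(u)$), uniquely up to an overall scalar factor, and this $K(u)$ satisfies the (graded) reflection equation $$R_{12}(u-v)\,K_{13}(u)\,R_{12}(u+v)\,K_{23}(v)=K_{23}(v)\,R_{12}(u+v)\,K_{13}(u)\,R_{12}(u-v)$$ on $\mathcal V\otimes\mathcal V\otimes\mathcal W$, $\mathcal V=\mathcal W=\mathbb{C}^{1|1}$, subscripts indicating the tensor factors acted on.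
   Context: $\mathcal{Y}(\mathfrak{gl}(1|1))$ is the Yangian (first realization, a Hopf superalgebra with graded tensor products) with formal deformation parameter $\alpha$, generated by odd $E^\pm,\widehat E^\pm$ and even $H,H_2,\widehat H,\widehat H_2$, with $\{E^+,E^-\}=H$, $\{E^\pm,\widehat E^\mp\}=\widehat H$, $(E^\pm)^2=0$, $\{E^\pm,\widehat E^\pm\}=0$, $H$ and $\widehat H$ central, $[H_2,E^\pm]=\pm2E^\pm$, $[H_2,\widehat E^\pm]=[\widehat H_2,E^\pm]=\pm2\widehat E^\pm$, $[H_2,\widehat H_2]=0$, together with the Yangian Serre-type relations. Coproduct: $\Delta(x)=x\otimes1+1\otimes x$ for $x\in\{E^\pm,H,H_2,\widehat H\}$, $\Delta(\widehat H_2)=\widehat H_2\otimes1+1\otimes\widehat H_2-\alpha(E^+\otimes E^-+E^-\otimes E^+)$, $\Delta(\widehat E^\pm)=\widehat E^\pm\otimes1+1\otimes\widehat E^\pm\mp\frac{\alpha}{2}(E^\pm\otimes H-H\otimes E^\pm)$. Evaluation representation on $\mathcal V$ with basis $v_1$ (even), $v_2$ (odd): $T_u(E^+)=e_{1,2}$, $T_u(E^-)=e_{2,1}$, $T_u(H)=e_{1,1}+e_{2,2}$, $T_u(H_2)=e_{1,1}-e_{2,2}$, $T_u(\widehat X)=u\,T_u(X)$ for $X=E^\pm,H,H_2$, and $T_u(\alpha)=1$. The boundary representation $T_s$ on $\mathcal W$ is the same with $u$ replaced by $s$. Tensor products of representations and operators are graded. $R$-matrix, as an (even) operator on $\mathcal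 V\otimes\mathcal V$ in the basis $v_1\otimes v_1,v_1\otimes v_2,v_2\otimes v_1,v_2\otimes v_2$: $$R(u)=\begin{pmatrix}1&0&0&0\\0&r&1-r&0\\0&1-r&r&0\\0&0&0&-1+2r\end{pmatrix},\qquad r=\frac{u}{u+1}.$$ All identities are identities of rational functions in $u,v$. *)

(* Defs.v *)
From HB Require Import structures.
From mathcomp Require Import all_boot all_order all_algebra.
From mathcomp Require Import reals.
From mathcomp.real_closed Require Import complex mxtens.
From mathcomp.multinomials Require Import monalg.

Set Implicit Arguments.
Unset Strict Implicit.
Unset Printing Implicit Defensive.

Import GRing.Theory.
Local Open Scope ring_scope.

(* The free associative unital algebra on X over K. *)
Notation free_alg K X := {malg K[{fmonom X}]}.

Definition fvar (K : nzRingType) (X : choiceType) (x : X) : free_alg K X :=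
  << fmu x >>.

(* The ring morphism out of the free algebra given by h on scalars and f on
   generators; it is multiplicative as soon as the values of h are central,
   which is the case in all uses below. *)
Definition free_map (K : nzRingType) (X : choiceType) (A : nzRingType)
    (h : K -> A) (f : X -> A) : free_alg K X -> A :=
  mmap h (fun m : {fmonom X} => \prod_(x <- (m : seq X)) f x).

Inductive ideal (A : nzRingType) (S : A -> Prop) : A -> Prop :=
| ideal_gen x : S x -> ideal S x
| ideal0 : ideal S 0
| idealD x y : ideal S x -> ideal S y -> ideal S (x + y)
| idealMl a x : ideal S x -> ideal S (a * x)
| idealMr a x : ideal S x -> ideal S (x * a).

Inductive subalg (K : nzRingType) (A : lalgType K) (S : A -> Prop) : A -> Prop :=
| subalg_gen x : S x -> subalg S x
| subalg_scalar (c : K) : subalg S c%:A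
| subalgD x y : subalg S x -> subalg S y -> subalg S (x + y)
| subalgM x y : subalg S x -> subalg S y -> subalg S (x * y).

Definition comm (A : nzRingType) (x y : A) := x * y - y * x.
Definition acomm (A : nzRingType) (x y : A) := x * y + y * x.

(* [true] is the sign +, [false] the sign -. *)
Definition sgn (A : nzRingType) (b : bool) : A := (-1) ^+ ~~ b.

Inductive gl11 := gE of bool | gH | gH2.

Definition gl11_code (x : gl11) : option (option bool) :=
  match x with gE b => Some (Some b) | gH => Some None | gH2 => None end.
Definition gl11_decode (c : option (option bool)) : gl11 :=
  match c with Some (Some b) => gE b | Some None => gH | None => gH2 end.
Lemma gl11_codeK : cancel gl11_code gl11_decode. Proof. by case. Qed.
HB.instance Definition _ := Choice.copy gl11 (can_type gl11_codeK).

Definition gl11_odd (x : gl11) : bool := if x is gE _ then true else false.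

(* (x, false) is the level-zero generator x, (x, true) the level-one
   generator usually written with a hat. *)
Notation ygen := (gl11 * bool)%type.

Definition ygen_odd (g : ygen) : bool := gl11_odd g.1.

Section Yangian.
Variable C : fieldType.

(* The deformation parameter alpha is the variable of the ring of scalars
   {poly C}.  Elements of the Yangian are represented by elements of [Y],
   two of which are equal in the Yangian when they differ by an element of
   [yideal].  In the same way [YY] represents the graded tensor square of the
   Yangian (over {poly C}), [inl g] standing for g (x) 1 and [inr g] for
   1 (x) g, with [yyideal] the ideal of relations. *)
Definition Y := free_alg {poly C} ygen.
Definition YY := free_alg {poly C} (ygen + ygen)%type.

Definition yscal (X : choiceType) (p : {poly C}) : free_alg {poly C} X := p%:A.
Definition half : {poly C} := (2%:R^-1)%:P.

Definition yE (b : bool) : Y := fvar _ (gE b, false).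
Definition yH : Y := fvar _ (gH, false).
Definition yH2 : Y := fvar _ (gH2, false).
Definition yEh (b : bool) : Y := fvar _ (gE b, true).
Definition yHh : Y := fvar _ (gH, true).
Definition yH2h : Y := fvar _ (gH2, true).

Inductive yrel : Y -> Prop :=
| yrel_EE : yrel (acomm (yE true) (yE false) - yH)
| yrel_EEh b : yrel (acomm (yE b) (yEh (~~ b)) - yHh)
| yrel_Esq b : yrel (yE b ^+ 2)
| yrel_EEhsame b : yrel (acomm (yE b) (yEh b))
| yrel_H g : yrel (comm yH (fvar _ g))
| yrel_Hh g : yrel (comm yHh (fvar _ g))
| yrel_H2E b : yrel (comm yH2 (yE b) - sgn _ b * 2%:R * yE b)
| yrel_H2Eh b : yrel (comm yH2 (yEh b) - sgn _ b * 2%:R * yEh b)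
| yrel_H2hE b : yrel (comm yH2h (yE b) - sgn _ b * 2%:R * yEh b)
| yrel_H2H2h : yrel (comm yH2 yH2h).

(* [serre] is the set of left-hand sides of the Serre-type relations. *)
Definition yideal (serre : Y -> Prop) : Y -> Prop :=
  ideal (fun x => yrel x \/ serre x).

Definition leg1 : Y -> YY :=
  free_map (yscal _) (fun g => fvar {poly C} (inl g : ygen + ygen)).
Definition leg2 : Y -> YY :=
  free_map (yscal _) (fun g => fvar {poly C} (inr g : ygen + ygen)).
Definition yten (x y : Y) : YY := leg1 x * leg2 y.

Inductive yyrel (serre : Y -> Prop) : YY -> Prop :=
| yyrel_leg1 x : yrel x \/ serre x -> yyrel serre (leg1 x)
| yyrel_leg2 x : yrel x \/ serre x -> yyrel serre (leg2 x)
| yyrel_cross g h :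
    yyrel serre (leg2 (fvar _ h) * leg1 (fvar _ g) -
                 (-1) ^+ (ygen_odd g && ygen_odd h) * yten (fvar _ g) (fvar _ h)).

Definition yyideal (serre : Y -> Prop) : YY -> Prop := ideal (yyrel serre).

Definition coproduct_gen (g : ygen) : YY :=
  let x : Y := fvar _ g in
  let primitive := yten x 1 + yten 1 x in
  match g with
  | (gH2, true) =>
      primitive - 'X *: (yten (yE true) (yE false) + yten (yE false) (yE true))
  | (gE b, true) =>
      primitive - ((sgn _ b * half) * 'X) *: (yten (yE b) yH - yten yH (yE b))
  | _ => primitive
  end.

Definition coproduct : Y -> YY := free_map (yscal _) coproduct_gen.

Definition twE (t : C) (b : bool) : Y :=
  (sgn _ b * half) *:
    (comm yH2h (yEh b) +
     'X *: ((sgn _ b * t%:P) *: yEh b + yE b * yHh - yEh b * yH)).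

Definition twH (t : C) (b : bool) : Y := acomm (yE b) (twE t (~~ b)).

Inductive twgen (t : C) : Y -> Prop :=
| twgen_E b : twgen t (yE b)
| twgen_H : twgen t yH
| twgen_H2 : twgen t yH2
| twgen_twE b : twgen t (twE t b)
| twgen_twH b : twgen t (twH t b).

(* x represents an element of the subalgebra generated by the classes of the
   elements of [twgen t]. *)
Definition twisted_yangian (serre : Y -> Prop) (t : C) (x : Y) : Prop :=
  exists2 y : Y, subalg (twgen t) y & yideal serre (x - y).

End Yangian.

(* Basis vectors of C^{1|1}: index 0 is even, index 1 is odd. *)
Definition par2 (i : 'I_2) : bool := odd i.

Definition par_tens (m n : nat) (p : 'I_m -> bool) (q : 'I_n -> bool)
    (i : 'I_(m * n)) : bool :=
  p (mxtens_unindex i).1 (+) q (mxtens_unindex i).2.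

(* The matrix of A (x) B in the basis v_j (x) w_l in lexicographic order,
   where (A (x) B)(v (x) w) = (-1)^(|B||v|) A v (x) B w. *)
Definition gtens (F : nzRingType) (m n : nat) (p : 'I_m -> bool) (q : 'I_n -> bool)
    (A : 'M[F]_m) (B : 'M[F]_n) : 'M[F]_(m * n) :=
  \matrix_(a, b)
    let (i, k) := mxtens_unindex a in let (j, l) := mxtens_unindex b in
    (-1) ^+ ((q k (+) q l) && p j) * (A i j * B k l).

(* The graded flip v_j (x) v_l |-> (-1)^(|j||l|) v_l (x) v_j. *)
Definition gflip (F : nzRingType) : 'M[F]_4 :=
  \matrix_(a < 2 * 2, b < 2 * 2)
    let (i, k) := mxtens_unindex a in let (j, l) := mxtens_unindex b in
    (-1) ^+ (par2 j && par2 l) * ((i == l) && (k == j))%:R.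

(* An operator on C^{1|1} (x) C^{1|1} acting on two of the factors of the
   triple tensor product. *)
Definition op12 (F : nzRingType) (M : 'M[F]_4) : 'M[F]_8 :=
  @gtens F (2 * 2) 2 (par_tens par2 par2) par2 M 1%:M.
Definition op23 (F : nzRingType) (M : 'M[F]_4) : 'M[F]_8 :=
  @gtens F 2 (2 * 2) par2 (par_tens par2 par2) 1%:M M.
Definition op13 (F : nzRingType) (M : 'M[F]_4) : 'M[F]_8 :=
  op23 (gflip F) *m op12 M *m op23 (gflip F).

Definition Rmatrix (F : fieldType) (u : F) : 'M[F]_4 :=
  let r := u / (u + 1) in
  \matrix_(i < 4, j < 4)
    nth 0 (nth [::] [:: [:: 1; 0;     0;     0];
                        [:: 0; r;     1 - r; 0];
                        [:: 0; 1 - r; r;     0];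
                        [:: 0; 0;     0;     -1 + 2%:R * r]] i) j.

Notation ratfun C := {fraction {poly C}}.
(* C(u, v), as the field of fractions of C[u][v] *)
Notation ratfun2 C := {fraction {poly {poly C}}}.

Section Evaluation.
Variable C : fieldType.

Definition rconst (c : C) : ratfun C := tofrac c%:P.
Definition rvar : ratfun C := tofrac 'X.

Definition uvar : ratfun2 C := tofrac 'X%:P.
Definition vvar : ratfun2 C := tofrac 'X.

(* Substitution of w for the variable in a rational function; for w
   transcendental over C, as in all uses below, this does not depend on the
   chosen fraction, whose denominator does not vanish at w. *)
Definition rsubst (w : ratfun2 C) (f : ratfun C) : ratfun2 C :=
  let ev (p : {poly C}) := (map_poly (fun c : C => tofrac c%:P%:P) p).[w] in
  ev (\n_(repr f)) / ev (\d_(repr f)).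

(* Scalars p(alpha) act with alpha = 1. *)
Definition alpha1 (n : nat) (p : {poly C}) : 'M[ratfun C]_n := (rconst p.[1])%:M.

Definition gl11_rep (x : gl11) : 'M[ratfun C]_2 :=
  match x with
  | gE true => delta_mx 0 1
  | gE false => delta_mx 1 0
  | gH => delta_mx 0 0 + delta_mx 1 1
  | gH2 => delta_mx 0 0 - delta_mx 1 1
  end.

Definition T_gen (w : ratfun C) (g : ygen) : 'M[ratfun C]_2 :=
  if g.2 then w *: gl11_rep g.1 else gl11_rep g.1.

Definition T (w : ratfun C) : Y C -> 'M[ratfun C]_2 :=
  free_map (@alpha1 2) (T_gen w).

Definition TT_gen (w w' : ratfun C) (g : ygen + ygen) : 'M[ratfun C]_4 :=
  match g with
  | inl x => gtens par2 par2 (T_gen w x) 1%:M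
  | inr y => gtens par2 par2 1%:M (T_gen w' y)
  end.

Definition TT (w w' : ratfun C) : YY C -> 'M[ratfun C]_4 :=
  free_map (@alpha1 4) (TT_gen w w').

(* The Serre-type relations are left arbitrary, subject to the facts that the
   coproduct and the evaluation representations are well defined on the
   Yangian they define. *)
Definition serre_compatible (serre : Y C -> Prop) : Prop :=
  (forall x, serre x -> yyideal serre (coproduct x)) /\
  (forall x, serre x -> forall w, T w x = 0).

Definition intertwines (B : Y C -> Prop) (s : C) (K : 'M[ratfun C]_4) : Prop :=
  forall b, B b ->
    TT (- rvar) (rconst s) (coproduct b) *m K =
    K *m TT rvar (rconst s) (coproduct b).

Definition reflection_equation (K : 'M[ratfun C]_4) : Prop :=
  let R12 w := op12 (Rmatrix w) in
  let K13 w := op13 (map_mx (rsubst w) K) in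
  let K23 w := op23 (map_mx (rsubst w) K) in
  let u := uvar in let v := vvar in
  R12 (u - v) *m K13 u *m R12 (u + v) *m K23 v =
  K23 v *m R12 (u + v) *m K13 u *m R12 (u - v).

End Evaluation.

(* Main.v *)
Require Import Defs.
From HB Require Import structures.
From mathcomp Require Import all_boot all_order all_algebra.
From mathcomp Require Import reals ring generic_quotient.
From mathcomp.real_closed Require Import complex mxtens.
From mathcomp.multinomials Require Import monalg.

Set Implicit Arguments.
Unset Strict Implicit.
Unset Printing Implicit Defensive.
Local Open Scope ring_scope.
Import GRing.Theory.

(* K(u) = (u^2 - s^2 + 1) + 2 u P, where P is the graded flip.

   The level-zero generators act on V (x) W independently of u, and the
   operators commuting with E^+, E^- and H_2 are exactly the span of 1 and P.
   On the remaining generators,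
     (T_u (x) T_s)(Delta (EE^b)) =
       (u^2 -+ u + 1/4) (E^b (x) 1) + (s^2 +- u - 3/4) (1 (x) E^b),
   for EE^b the twisted generator with t = 0, and intertwining a + c P between
   its values at u and -u amounts to 2 u a = (u^2 - s^2 + 1) c. Intertwining for
   HH follows from its expression as an anticommutator.

   R(w) is proportional to w + P, so the reflection equation is an identity
   between elements of the image of the group algebra of S_3, in which it
   holds already. *)

(** * Universal property of the free algebra *)

Section FreeAlgebra.
Variables (K : comNzRingType) (X : choiceType).
Local Notation FA := (free_alg K X).

(** An element is a sum of scalar multiples of words and a word is a product of letters, so closure
    under sums and products leaves only scalars and letters. *)
Lemma free_alg_ind (P : FA -> Prop) :
    (forall c : K, P c%:A) -> (forall x, P (fvar K x)) ->
    (forall a b, P a -> P b -> P (a + b)) ->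
    (forall a b, P a -> P b -> P (a * b)) ->
  forall a, P a.
Proof.
move=> Pscal Pvar Padd Pmul a; rewrite (monalgE a).
apply: big_ind => [|x y Px Py|m _].
- by have := Pscal 0; rewrite scale0r.
- exact: Padd.
have -> : << a@_m *g m >> = ((a@_m)%:A : FA) * (<< m >> : FA).
  by rewrite -mul_malgC mulr1 malgM_def fgmulUU mulr1 mul1m.
apply/Pmul => //.
case: m => s; elim: s => [|x s IHs].
  suff -> : FMonom [::] = mone :> {fmonom X}.
    by have := Pscal 1; rewrite scale1r.
  by apply: val_inj; rewrite /= fm1.
suff -> : FMonom (x :: s) = mmul (fmu x) (FMonom s).
  by have := Pmul _ _ (Pvar x) IHs; rewrite malgM_def fgmulUU mulr1.
by apply: val_inj; rewrite /= fmM fmU.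
Qed.

Section Morphism.
Variables (A : nzRingType) (h : {rmorphism K -> A}) (f : X -> A).
Hypothesis hC : forall c a, GRing.comm (h c) a.

Definition fprod (m : {fmonom X}) : A := \prod_(x <- (m : seq X)) f x.

Lemma fprod_mmorphism : mmorphism fprod.
Proof.
by split=> [m1 m2|]; rewrite /fprod ?fmM ?big_cat ?fm1 ?big_nil.
Qed.

HB.instance Definition _ := isMultiplicative.Build _ _ fprod fprod_mmorphism.

Lemma free_map_zmod_morphism : zmod_morphism (free_map h f).
Proof. exact: (raddfB (mmap h fprod)). Qed.

Lemma free_map_monoid_morphism : monoid_morphism (free_map h f).
Proof.
have [mM m1] := @commr_mmap_is_multiplicative _ _ _ h fprod
  (fun g m m' => hC _ _).
by split.
Qed.

Lemma free_map_var x : free_map h f (fvar K x) = f x.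
Proof.
transitivity (h 1 * fprod (fmu x)); first exact: (@mmapU _ _ _ h fprod).
by rewrite rmorph1 mul1r /fprod fmU big_seq1.
Qed.

Lemma free_mapZ c a : free_map h f (c *: a) = h c * free_map h f a.
Proof. exact: (@mmapZ _ _ _ h fprod). Qed.

End Morphism.
End FreeAlgebra.

Lemma scalar_alg_comm (K : comNzRingType) (A : lalgType K) (c d : K) :
  GRing.comm c%:A (d%:A : A).
Proof. by rewrite /GRing.comm -!scalerAl !mul1r !scalerA mulrC. Qed.

(** Supplies the centrality hypothesis [hC] when the target of [free_map] is itself a free algebra,
    as for the legs and the coproduct. *)
Lemma free_alg_scalar_comm (K : comNzRingType) (X : choiceType) (c : K)
  (a : free_alg K X) : GRing.comm c%:A a.
Proof.
elim/free_alg_ind: a => [d|x|a b|a b].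
- exact: scalar_alg_comm.
- have -> : c%:A = << c *g mone >> :> free_alg K X by rewrite -mul_malgC mulr1.
  apply: etrans (fgmulUU _ _ _ _) (etrans _ (esym (fgmulUU _ _ _ _))).
  by rewrite mulr1 mul1r mul1m mulm1.
- exact: commrD.
- exact: commrM.
Qed.

(** * Representations, legs and coproduct as ring morphisms *)

Section YangianMorphisms.
Variable C : fieldType.
Implicit Types (w : ratfun C).

Lemma alpha1_zmod_morphism n : zmod_morphism (@alpha1 C n.+1).
Proof.
by move=> p q; rewrite /alpha1 /rconst hornerD hornerN !raddfB.
Qed.

Lemma alpha1_monoid_morphism n : monoid_morphism (@alpha1 C n.+1).
Proof.
split=> [|p q]; first by rewrite /alpha1 /rconst hornerC !rmorph1.
by rewrite /alpha1 /rconst hornerM !rmorphM.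
Qed.

HB.instance Definition _ n :=
  GRing.isZmodMorphism.Build _ _ (@alpha1 C n.+1) (@alpha1_zmod_morphism n).
HB.instance Definition _ n :=
  GRing.isMonoidMorphism.Build _ _ (@alpha1 C n.+1) (@alpha1_monoid_morphism n).

Lemma alpha1_comm n p (A : 'M[ratfun C]_n.+1) : GRing.comm (alpha1 n.+1 p) A.
Proof. exact: (comm_scalar_mx (rconst p.[1]) A). Qed.

Lemma yscal_comm (X : choiceType) (p : {poly C}) a :
  GRing.comm (GRing.in_alg (free_alg {poly C} X) p) a.
Proof. exact: free_alg_scalar_comm. Qed.

HB.instance Definition _ w := GRing.isZmodMorphism.Build _ _ (T w)
  (@free_map_zmod_morphism _ _ _ (@alpha1 C 2) (T_gen w)).
HB.instance Definition _ w := GRing.isMonoidMorphism.Build _ _ (T w)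
  (@free_map_monoid_morphism _ _ _ (@alpha1 C 2) (T_gen w) (@alpha1_comm 1)).

HB.instance Definition _ w w' := GRing.isZmodMorphism.Build _ _ (TT w w')
  (@free_map_zmod_morphism _ _ _ (@alpha1 C 4) (TT_gen w w')).
HB.instance Definition _ w w' := GRing.isMonoidMorphism.Build _ _ (TT w w')
  (@free_map_monoid_morphism _ _ _ (@alpha1 C 4) (TT_gen w w')
     (@alpha1_comm 3)).

HB.instance Definition _ := GRing.isZmodMorphism.Build _ _ (@leg1 C)
  (@free_map_zmod_morphism _ _ _ (GRing.in_alg (YY C)) _).
HB.instance Definition _ := GRing.isMonoidMorphism.Build _ _ (@leg1 C)
  (@free_map_monoid_morphism _ _ _ (GRing.in_alg (YY C)) _ (@yscal_comm _)).
HB.instance Definition _ := GRing.isZmodMorphism.Build _ _ (@leg2 C)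
  (@free_map_zmod_morphism _ _ _ (GRing.in_alg (YY C)) _).
HB.instance Definition _ := GRing.isMonoidMorphism.Build _ _ (@leg2 C)
  (@free_map_monoid_morphism _ _ _ (GRing.in_alg (YY C)) _ (@yscal_comm _)).
HB.instance Definition _ := GRing.isZmodMorphism.Build _ _ (@coproduct C)
  (@free_map_zmod_morphism _ _ _ (GRing.in_alg (YY C)) _).
HB.instance Definition _ := GRing.isMonoidMorphism.Build _ _ (@coproduct C)
  (@free_map_monoid_morphism _ _ _ (GRing.in_alg (YY C)) _ (@yscal_comm _)).

Lemma TD w : {morph T w : a b / a + b}. Proof. exact: rmorphD. Qed.
Lemma TM w : {morph T w : a b / a * b}. Proof. exact: rmorphM. Qed.
Lemma TTD w w' : {morph TT w w' : a b / a + b}. Proof. exact: rmorphD. Qed.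
Lemma TTN w w' : {morph TT w w' : a / - a}. Proof. exact: rmorphN. Qed.
Lemma TTM w w' : {morph TT w w' : a b / a * b}. Proof. exact: rmorphM. Qed.
Lemma leg1D : {morph @leg1 C : a b / a + b}. Proof. exact: rmorphD. Qed.
Lemma leg1M : {morph @leg1 C : a b / a * b}. Proof. exact: rmorphM. Qed.
Lemma leg2D : {morph @leg2 C : a b / a + b}. Proof. exact: rmorphD. Qed.
Lemma leg2M : {morph @leg2 C : a b / a * b}. Proof. exact: rmorphM. Qed.

Lemma T_var w g : T w (fvar _ g) = T_gen w g.
Proof. exact: (@free_map_var _ _ _ (@alpha1 C 2)). Qed.
Lemma TT_var w w' g : TT w w' (fvar _ g) = TT_gen w w' g.
Proof. exact: (@free_map_var _ _ _ (@alpha1 C 4)). Qed.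
Lemma leg1_var g : leg1 (fvar {poly C} g) = fvar _ (inl g).
Proof. exact: (@free_map_var _ _ _ (GRing.in_alg (YY C))). Qed.
Lemma leg2_var g : leg2 (fvar {poly C} g) = fvar _ (inr g).
Proof. exact: (@free_map_var _ _ _ (GRing.in_alg (YY C))). Qed.
Lemma coproduct_var g : coproduct (fvar {poly C} g) = coproduct_gen C g.
Proof. exact: (@free_map_var _ _ _ (GRing.in_alg (YY C))). Qed.

Lemma TZ w p a : T w (p *: a) = rconst p.[1] *: T w a.
Proof.
rewrite -mul_scalar_mx; exact: (@free_mapZ _ _ _ (@alpha1 C 2) (T_gen w)).
Qed.
Lemma TTZ w w' p a : TT w w' (p *: a) = rconst p.[1] *: TT w w' a.
Proof.
rewrite -mul_scalar_mx; exact: (@free_mapZ _ _ _ (@alpha1 C 4) (TT_gen w w')).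
Qed.
Lemma leg1Z p (a : Y C) : leg1 (p *: a) = p *: leg1 a.
Proof.
rewrite -[RHS]mulr_algl; exact: (@free_mapZ _ _ _ (GRing.in_alg (YY C))).
Qed.
Lemma leg2Z p (a : Y C) : leg2 (p *: a) = p *: leg2 a.
Proof.
rewrite -[RHS]mulr_algl; exact: (@free_mapZ _ _ _ (GRing.in_alg (YY C))).
Qed.
Lemma coproductZ p (a : Y C) : coproduct (p *: a) = p *: coproduct a.
Proof.
rewrite -[RHS]mulr_algl; exact: (@free_mapZ _ _ _ (GRing.in_alg (YY C))).
Qed.

Lemma Y_ind (P : Y C -> Prop) :
    (forall c, P c%:A) -> (forall g, P (fvar _ g)) ->
    (forall a b, P a -> P b -> P (a + b)) ->
    (forall a b, P a -> P b -> P (a * b)) -> forall a, P a.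
Proof. exact: free_alg_ind. Qed.

Lemma ideal_kernel (A B : nzRingType) (f : {rmorphism A -> B}) (S : A -> Prop) :
  (forall x, S x -> f x = 0) -> forall x, ideal S x -> f x = 0.
Proof.
move=> fS x; elim=> {x} [x /fS //||x y _ fx _ fy|a x _ fx|a x _ fx].
- exact: rmorph0.
- by rewrite rmorphD fx fy addr0.
- by rewrite rmorphM fx mulr0.
- by rewrite rmorphM fx mul0r.
Qed.

End YangianMorphisms.

(** * Graded tensor products of matrices and the Koszul sign rule *)

Section GradedTensor.
Variables (F : comNzRingType) (m n : nat) (p : 'I_m -> bool) (q : 'I_n -> bool).
Local Notation gt := (@gtens F m n p q).

Lemma gtensE (A : 'M[F]_m) (B : 'M[F]_n) i k j l :
  gt A B (mxtens_index (i, k)) (mxtens_index (j, l)) =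
  (-1) ^+ ((q k (+) q l) && p j) * (A i j * B k l).
Proof. by rewrite mxE !mxtens_indexK. Qed.

Lemma mulmx_mxtensE (X Y : 'M[F]_(m * n)) a b :
  (X *m Y) a b =
  \sum_i \sum_k X a (mxtens_index (i, k)) * Y (mxtens_index (i, k)) b.
Proof.
rewrite mxE pair_big (reindex (@mxtens_index m n)) /=; last first.
  exists (@mxtens_unindex m n) => ? _;
    by rewrite (mxtens_indexK, mxtens_unindexK).
by apply: eq_bigr; case.
Qed.

Lemma gtensDl A A' B : gt (A + A') B = gt A B + gt A' B.
Proof.
apply/matrixP=> a b; case: (mxtens_indexP a) (mxtens_indexP b) => [i k] [j l].
by rewrite [RHS]mxE !gtensE mxE mulrDl mulrDr.
Qed.

Lemma gtensDr A B B' : gt A (B + B') = gt A B + gt A B'.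
Proof.
apply/matrixP=> a b; case: (mxtens_indexP a) (mxtens_indexP b) => [i k] [j l].
by rewrite [RHS]mxE !gtensE mxE !mulrDr.
Qed.

Lemma gtensZl c A B : gt (c *: A) B = c *: gt A B.
Proof.
apply/matrixP=> a b; case: (mxtens_indexP a) (mxtens_indexP b) => [i k] [j l].
by rewrite [RHS]mxE !gtensE mxE; ring.
Qed.

Lemma gtensZr c A B : gt A (c *: B) = c *: gt A B.
Proof.
apply/matrixP=> a b; case: (mxtens_indexP a) (mxtens_indexP b) => [i k] [j l].
by rewrite [RHS]mxE !gtensE mxE; ring.
Qed.

Lemma gtens11 : gt 1%:M 1%:M = 1%:M.
Proof.
apply/matrixP=> a b; case: (mxtens_indexP a) (mxtens_indexP b) => [i k] [j l].
rewrite gtensE !mxE (can_eq (@mxtens_indexK m n)) xpair_eqE.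
case: eqP => _; last by rewrite mul0r mulr0.
by case: eqP => [->|_]; rewrite ?addbb ?mulr1 ?mul1r // !mulr0.
Qed.

(** No sign survives: the identity forces [k = l] in the second factor, where [q k (+) q l]
    vanishes. *)
Lemma mul_gtensl A A' : gt A 1%:M *m gt A' 1%:M = gt (A *m A') 1%:M.
Proof.
apply/matrixP=> a b; case: (mxtens_indexP a) (mxtens_indexP b) => [i k] [j l].
rewrite mulmx_mxtensE gtensE [(A *m A') _ _]mxE mulr_suml mulr_sumr.
apply: eq_bigr => i' _; rewrite (bigD1 k) //= !gtensE !mxE eqxx addbb /=.
rewrite big1 => [|k' /negPf k'k]; first by ring.
by rewrite gtensE [1%:M k _]mxE eq_sym k'k /=; ring.
Qed.

(** The signs multiply correctly: the identity fixes the index of the first factor, and the parity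
    change [q k (+) q l] is additive along composable entries. *)
Lemma mul_gtensr B B' : gt 1%:M B *m gt 1%:M B' = gt 1%:M (B *m B').
Proof.
apply/matrixP=> a b; case: (mxtens_indexP a) (mxtens_indexP b) => [i k] [j l].
rewrite mulmx_mxtensE gtensE [(B *m B') _ _]mxE (bigD1 i) //=.
rewrite [X in _ + X]big1 => [|i' /negPf i'i]; last first.
  by apply: big1 => k' _; rewrite gtensE mxE eq_sym i'i /=; ring.
rewrite addr0; have [<-|/negPf ij] := eqVneq i j; last first.
  rewrite [1%:M i j]mxE ij mul0r mulr0; apply: big1 => k' _.
  by rewrite !gtensE [1%:M i j]mxE ij /=; ring.
rewrite !mulr_sumr; apply: eq_bigr => k' _; rewrite !gtensE !mxE eqxx /=.
by case: (q k); case: (q k'); case: (q l); case: (p i) => /=; ring.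
Qed.

(** [x] and [y] are the parities of [A] and [B]. Each side has one surviving term; its sign involves
    the row index of [A] on the left and the column index on the right, and these differ in parity
    by [x] wherever [A] is nonzero. *)
Lemma mul_gtens_cross (A : 'M[F]_m) (B : 'M[F]_n) (x y : bool) :
    (forall i j, p i (+) p j != x -> A i j = 0) ->
    (forall k l, q k (+) q l != y -> B k l = 0) ->
  gt 1%:M B *m gt A 1%:M = (-1) ^+ (x && y) *: (gt A 1%:M *m gt 1%:M B).
Proof.
move=> Ax By; apply/matrixP=> a b.
case: (mxtens_indexP a) (mxtens_indexP b) => [i k] [j l].
rewrite [RHS]mxE !mulmx_mxtensE (bigD1 i) //= (bigD1 l) //=.
rewrite [X in _ + X + _]big1 => [|l' /negPf l'l]; last first.
  by rewrite !gtensE [1%:M l' _]mxE l'l /=; ring.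
rewrite [X in _ + X]big1 => [|i' /negPf i'i]; last first.
  by apply: big1 => k' _; rewrite gtensE [1%:M i _]mxE eq_sym i'i /=; ring.
rewrite (bigD1 j) //= (bigD1 k) //=.
rewrite [X in _ * (_ + X + _)]big1 => [|k' /negPf k'k]; last first.
  by rewrite !gtensE [1%:M k _]mxE eq_sym k'k /=; ring.
rewrite [X in _ * (_ + X)]big1 => [|j' /negPf j'j]; last first.
  by apply: big1 => k' _; rewrite !gtensE [1%:M j' _]mxE j'j /=; ring.
rewrite !gtensE !mxE !eqxx !addbb /=.
have [<-|/Ax ->] := eqVneq (p i (+) p j) x; last by ring.
have [<-|/By ->] := eqVneq (q k (+) q l) y; last by ring.
by case: (p i); case: (p j); case: (q k (+) q l) => /=; ring.
Qed.

End GradedTensor.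

(** * Action of the two legs of the tensor square *)

Section Legs.
Variable C : fieldType.
Implicit Types (w : ratfun C).

Lemma TT_leg1 w w' x : TT w w' (leg1 x) = gtens par2 par2 (T w x) 1%:M.
Proof.
elim/Y_ind: x => [c|g|a b IHa IHb|a b IHa IHb].
- by rewrite leg1Z TTZ TZ !rmorph1 gtensZl gtens11.
- by rewrite leg1_var TT_var T_var.
- rewrite leg1D TTD [T w _]TD gtensDl; exact: (f_equal2 +%R IHa IHb).
- rewrite leg1M TTM [T w _]TM -mul_gtensl; exact: (f_equal2 *%R IHa IHb).
Qed.

Lemma TT_leg2 w w' x : TT w w' (leg2 x) = gtens par2 par2 1%:M (T w' x).
Proof.
elim/Y_ind: x => [c|g|a b IHa IHb|a b IHa IHb].
- by rewrite leg2Z TTZ TZ !rmorph1 gtensZr gtens11.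
- by rewrite leg2_var TT_var T_var.
- rewrite leg2D TTD [T w' _]TD gtensDr; exact: (f_equal2 +%R IHa IHb).
- rewrite leg2M TTM [T w' _]TM -mul_gtensr; exact: (f_equal2 *%R IHa IHb).
Qed.

(** Supplies the parity hypotheses of [mul_gtens_cross], hence the cross relations of the graded
    tensor square. *)
Lemma T_gen_homog w g i j :
  par2 i (+) par2 j != ygen_odd g -> T_gen w g i j = 0.
Proof.
case: g i j => [[[]||] []] [[|[|?]] ?] [[|[|?]] ?] //=;
  by rewrite /T_gen /= ?mxE /= => _; ring.
Qed.

End Legs.

(** * The Yangian relations among images in an arbitrary ring *)

Section Relations.
Variables (A B : nzRingType) (f : {rmorphism A -> B}).
Variables (x y z : A) (x' y' z' : B).
Hypotheses (fx : f x = x') (fy : f y = y') (fz : f z = z').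

Lemma rmorph_commutator : f (comm x y) = comm x' y'.
Proof. by rewrite /comm rmorphB !rmorphM fx fy. Qed.

Lemma rmorph_anticommutator : f (acomm x y) = acomm x' y'.
Proof. by rewrite /acomm rmorphD !rmorphM fx fy. Qed.

Lemma rmorph_acommB : acomm x' y' = z' -> f (acomm x y - z) = 0.
Proof. by move=> xy; rewrite rmorphB rmorph_anticommutator fz xy subrr. Qed.

Lemma rmorph_commB b :
  comm x' y' = sgn B b * 2%:R * z' -> f (comm x y - sgn A b * 2%:R * z) = 0.
Proof.
move=> xy; rewrite rmorphB rmorph_commutator !rmorphM rmorph_sign rmorph_nat fz.
by rewrite xy subrr.
Qed.
End Relations.

(** Stated for arbitrary images of the generators because the relations are checked twice: for the
    evaluation matrices and for the images of the coproducts. *)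
Record yrelations (B : nzRingType) (g : ygen -> B) : Prop := YRelations {
  yEE : acomm (g (gE true, false)) (g (gE false, false)) = g (gH, false);
  yEEh b : acomm (g (gE b, false)) (g (gE (~~ b), true)) = g (gH, true);
  yEsq b : g (gE b, false) ^+ 2 = 0;
  yEEhsame b : acomm (g (gE b, false)) (g (gE b, true)) = 0;
  yHC x : comm (g (gH, false)) (g x) = 0;
  yHhC x : comm (g (gH, true)) (g x) = 0;
  yH2E b : comm (g (gH2, false)) (g (gE b, false)) =
    sgn B b * 2%:R * g (gE b, false);
  yH2Eh b : comm (g (gH2, false)) (g (gE b, true)) =
    sgn B b * 2%:R * g (gE b, true);
  yH2hE b : comm (g (gH2, true)) (g (gE b, false)) =
    sgn B b * 2%:R * g (gE b, true);
  yH2H2h : comm (g (gH2, false)) (g (gH2, true)) = 0 }.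

Lemma yrel_kernel (C : fieldType) (B : nzRingType) (f : {rmorphism Y C -> B})
    (g : ygen -> B) :
  (forall x, f (fvar _ x) = g x) -> yrelations g -> forall x, yrel x -> f x = 0.
Proof.
move=> fg [gEE gEEh gEsq gEEhs gHC gHhC gH2E gH2Eh gH2hE gH2H2h] x.
case=> [|b|b|b|y|y|b|b|b|].
- exact: (rmorph_acommB (fg _) (fg _) (fg _) gEE).
- exact: (rmorph_acommB (fg _) (fg _) (fg _) (gEEh b)).
- exact: (etrans (rmorphXn f 2 _)
    (etrans (congr1 (fun a => a ^+ 2) (fg _)) (gEsq b))).
- exact: (etrans (rmorph_anticommutator (fg _) (fg _)) (gEEhs b)).
- exact: (etrans (rmorph_commutator (fg _) (fg _)) (gHC y)).
- exact: (etrans (rmorph_commutator (fg _) (fg _)) (gHhC y)).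
- exact: (rmorph_commB (fg _) (fg _) (fg _) (gH2E b)).
- exact: (rmorph_commB (fg _) (fg _) (fg _) (gH2Eh b)).
- exact: (rmorph_commB (fg _) (fg _) (fg _) (gH2hE b)).
- exact: (etrans (rmorph_commutator (fg _) (fg _)) gH2H2h).
Qed.

Ltac mx_entries :=
  apply/matrixP; do 2 (case=> [[|[|[|[|?]]]] ?]//);
  rewrite ?(mxE, big_ord_recl, big_ord0) /=.

Lemma sgn2E (A : nzRingType) (b : bool) (a : A) :
  sgn A b * 2%:R * a = if b then a + a else - (a + a).
Proof.
by rewrite -mulrA mulr_natl mulr2n; case: b; rewrite /sgn ?mul1r ?mulN1r.
Qed.

Definition fmx (F : nzRingType) n (f : nat -> nat -> F) : 'M[F]_n :=
  \matrix_(i < n, j < n) f i j.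

(** The matrix product as a fold over [iota], which unfolds to an explicit expression once the size
    is a numeral. *)
Definition fmul (F : nzRingType) n (f g : nat -> nat -> F) (i j : nat) : F :=
  foldr (fun k z => f i k * g k j + z) 0 (iota 0 n).

Lemma fmxM (F : nzRingType) n f g :
  @fmx F n f *m fmx n g = fmx n (fmul n f g).
Proof.
apply/matrixP=> i j; rewrite !mxE.
transitivity (\sum_(0 <= k < n) f i k * g k j).
  by rewrite big_mkord; apply: eq_bigr => k _; rewrite !mxE.
by rewrite unlock /index_iota subn0.
Qed.

(** * Evaluation matrices, and matrices stored as lists of rows *)

Section ListMatrix.
Variable F : fieldType.
Implicit Types (w s h : F).

Definition gl11_mx (x : gl11) : 'M[F]_2 :=
  match x with
  | gE true => delta_mx 0 1
  | gE false => delta_mx 1 0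
  | gH => delta_mx 0 0 + delta_mx 1 1
  | gH2 => delta_mx 0 0 - delta_mx 1 1
  end.

Definition eval_gen w (g : ygen) : 'M[F]_2 :=
  if g.2 then w *: gl11_mx g.1 else gl11_mx g.1.

Lemma scalar_mx_comm0 n c (A : 'M[F]_n.+1) : comm (c%:M) A = 0.
Proof. by apply/eqP; rewrite subr_eq0; apply/eqP; exact: comm_scalar_mx. Qed.

Lemma eval_genH w l : eval_gen w (gH, l) = (if l then w else 1)%:M.
Proof. by case: l; rewrite /eval_gen /=; mx_entries; ring. Qed.

Lemma eval_gen_yrelations w : yrelations (eval_gen w).
Proof.
split=> [|[]|[]|[]|x|x|[]|[]|[]|]; rewrite ?eval_genH ?scalar_mx_comm0 //
  /acomm ?sgn2E /eval_gen /= /comm ?expr2 -!mulmxE.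
all: by mx_entries; ring.
Qed.

Definition lentry (L : seq (seq F)) i j := nth 0 (nth [::] L i) j.
Definition lmx n (f : nat -> nat -> F) := mkseq (fun i => mkseq (f i) n) n.
Definition smx n (L : seq (seq F)) : 'M[F]_n := fmx n (lentry L).

Lemma smx_lmx n f : smx n (lmx n f) = fmx n f.
Proof. by apply/matrixP=> i j; rewrite !mxE /lentry !nth_mkseq. Qed.

Lemma smx40 : smx 4 (nseq 4 (nseq 4 0)) = 0.
Proof.
by apply/matrixP=> -[[|[|[|[|?]]]] ?] [[|[|[|[|?]]]] ?]; rewrite !mxE.
Qed.

Lemma smxD n L M :
  smx n L + smx n M = smx n (lmx n (fun i j => lentry L i j + lentry M i j)).
Proof. by rewrite smx_lmx; apply/matrixP=> i j; rewrite !mxE. Qed.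

Lemma smxB n L M :
  smx n L - smx n M = smx n (lmx n (fun i j => lentry L i j - lentry M i j)).
Proof. by rewrite smx_lmx; apply/matrixP=> i j; rewrite !mxE. Qed.

Lemma smxN n L : - smx n L = smx n (lmx n (fun i j => - lentry L i j)).
Proof. by rewrite smx_lmx; apply/matrixP=> i j; rewrite !mxE. Qed.

Lemma smxZ n c L : c *: smx n L = smx n (lmx n (fun i j => c * lentry L i j)).
Proof. by rewrite smx_lmx; apply/matrixP=> i j; rewrite !mxE. Qed.

Lemma smxM n L M :
  smx n L *m smx n M = smx n (lmx n (fmul n (lentry L) (lentry M))).
Proof. by rewrite smx_lmx fmxM. Qed.

Lemma smx_scalar n (c : F) :
  c%:M = smx n (lmx n (fun i j => if i == j then c else 0)).
Proof.
by rewrite smx_lmx; apply/matrixP=> i j; rewrite !mxE -val_eqE /=; case: eqP.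
Qed.

End ListMatrix.

(** Pushes all matrix operations into the lists of entries, then splits an equality of 4 by 4
    matrices into scalar goals. *)
Ltac smx_eq :=
  rewrite ?(smxM, smxD, smxB, smxN, smxZ) ?smx_scalar
    ?(smxM, smxD, smxB, smxN, smxZ) /lmx /mkseq /fmul /lentry /=;
  rewrite ?(mul0r, mulr0, add0r, addr0, mul1r, mulr1, oppr0);
  congr (smx _ [:: [:: _; _; _; _]; [:: _; _; _; _];
                   [:: _; _; _; _]; [:: _; _; _; _]]).

(** * Explicit matrices for the action on V (x) W *)

Section TensorSquare.
Variable F : fieldType.
Implicit Types (w s h : F).

(* x (E^b (x) 1) + z (1 (x) E^b) *)
Definition odd_mx (b : bool) (x z : F) : 'M[F]_4 :=
  if b then smx 4 [:: [:: 0; z; x; 0]; [:: 0; 0; 0; x]; [:: 0; 0; 0; - z];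
                      [:: 0; 0; 0; 0]]
  else smx 4 [:: [:: 0; 0; 0; 0]; [:: z; 0; 0; 0]; [:: x; 0; 0; 0];
                 [:: 0; x; - z; 0]].

Definition H2_mx : 'M[F]_4 :=
  smx 4 [:: [:: 2%:R; 0; 0; 0]; [:: 0; 0; 0; 0]; [:: 0; 0; 0; 0];
            [:: 0; 0; 0; - 2%:R]].

(* The images of the generators under (T_w (x) T_s) o Delta; here h = 1/2. *)
Definition tensor_gen w s h (g : ygen) : 'M[F]_4 :=
  match g with
  | (gE b, false) => odd_mx b 1 1
  | (gE true, true) => odd_mx true (w - h) (s + h)
  | (gE false, true) => odd_mx false (w + h) (s - h)
  | (gH, l) => (if l then w + s else 2%:R)%:M
  | (gH2, false) => H2_mx
  | (gH2, true) =>
    smx 4 [:: [:: w + s; 0; 0; 0]; [:: 0; w - s; 1; 0]; [:: 0; -1; s - w; 0];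
              [:: 0; 0; 0; - (w + s)]]
  end.

(** Compatibility of the coproduct with the relations, seen after applying [T_w (x) T_s]: a finite
    check on matrices. *)
Lemma tensor_gen_yrelations w s h :
  h + h = 1 -> yrelations (tensor_gen w s h).
Proof.
move=> hh.
split=> [|[]|[]|[]|x|x|[]|[]|[]|];
  rewrite /= ?scalar_mx_comm0 // /acomm ?sgn2E /comm ?expr2 -!mulmxE.
all: rewrite /H2_mx -?smx40; smx_eq; try by ring.
(* The entries left over use that [h] is one half; expanding 1 as [h + h] makes them polynomial
   identities. *)
all: by rewrite ?(mulrN1, mulN1r, opprK) -hh; ring.
Qed.

End TensorSquare.

(** * The explicit matrices against the coproduct formulas *)

Section LegMatrices.
Variable F : fieldType.
Implicit Types (w s h : F).
Local Notation gt := (@gtens F 2 2 par2 par2).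

Definition leg1_list (x : gl11) : seq (seq F) :=
  match x with
  | gE true => [:: [:: 0; 0; 1; 0]; [:: 0; 0; 0; 1]; [:: 0; 0; 0; 0];
                   [:: 0; 0; 0; 0]]
  | gE false => [:: [:: 0; 0; 0; 0]; [:: 0; 0; 0; 0]; [:: 1; 0; 0; 0];
                    [:: 0; 1; 0; 0]]
  | gH => [:: [:: 1; 0; 0; 0]; [:: 0; 1; 0; 0]; [:: 0; 0; 1; 0];
              [:: 0; 0; 0; 1]]
  | gH2 => [:: [:: 1; 0; 0; 0]; [:: 0; 1; 0; 0]; [:: 0; 0; -1; 0];
               [:: 0; 0; 0; -1]]
  end.

(** The entry -1 in the odd cases is a Koszul sign: the generator passes the odd vector of the first
    factor. *)
Definition leg2_list (x : gl11) : seq (seq F) :=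
  match x with
  | gE true => [:: [:: 0; 1; 0; 0]; [:: 0; 0; 0; 0]; [:: 0; 0; 0; -1];
                   [:: 0; 0; 0; 0]]
  | gE false => [:: [:: 0; 0; 0; 0]; [:: 1; 0; 0; 0]; [:: 0; 0; 0; 0];
                    [:: 0; 0; -1; 0]]
  | gH => [:: [:: 1; 0; 0; 0]; [:: 0; 1; 0; 0]; [:: 0; 0; 1; 0];
              [:: 0; 0; 0; 1]]
  | gH2 => [:: [:: 1; 0; 0; 0]; [:: 0; -1; 0; 0]; [:: 0; 0; 1; 0];
               [:: 0; 0; 0; -1]]
  end.

Lemma gtens_leg1 x : gt (gl11_mx F x) 1%:M = smx 4 (leg1_list x).
Proof.
apply/matrixP=> a b; case: (mxtens_indexP a) (mxtens_indexP b) => [i k] [j l].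
rewrite gtensE !mxE /lentry.
case: x => [[]||]; case: i k j l => [[|[|?]] ?] [[|[|?]] ?] [[|[|?]] ?]
  [[|[|?]] ?] //=; rewrite !mxE /=.
all: by ring.
Qed.

Lemma gtens_leg2 x : gt 1%:M (gl11_mx F x) = smx 4 (leg2_list x).
Proof.
apply/matrixP=> a b; case: (mxtens_indexP a) (mxtens_indexP b) => [i k] [j l].
rewrite gtensE !mxE /lentry.
case: x => [[]||]; case: i k j l => [[|[|?]] ?] [[|[|?]] ?] [[|[|?]] ?]
  [[|[|?]] ?] //=; rewrite !mxE /=.
all: by ring.
Qed.

(** The subtracted term is the non-primitive part of the coproduct at alpha = 1; [TT_coproduct_var]
    makes the link with [coproduct]. *)
Lemma tensor_genE w s h g :
  tensor_gen w s h g =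
  gt (eval_gen w g) 1%:M + gt 1%:M (eval_gen s g) -
  match g with
  | (gH2, true) =>
    gt (gl11_mx F (gE true)) 1%:M *m gt 1%:M (gl11_mx F (gE false)) +
    gt (gl11_mx F (gE false)) 1%:M *m gt 1%:M (gl11_mx F (gE true))
  | (gE b, true) =>
    (sgn F b * h) *:
      (gt (gl11_mx F (gE b)) 1%:M *m gt 1%:M (gl11_mx F gH) -
       gt (gl11_mx F gH) 1%:M *m gt 1%:M (gl11_mx F (gE b)))
  | _ => 0
  end.
Proof.
case: g => [[[]||] []]; rewrite /eval_gen /sgn [tensor_gen _ _ _ _]/=
  [in RHS]/fst [in RHS]/snd ?(gtensZl, gtensZr, gtens_leg1, gtens_leg2) ?subr0
  /H2_mx /odd_mx /leg1_list /leg2_list.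
all: smx_eq; rewrite ?(expr0, expr1) //=.
all: by ring.
Qed.

End LegMatrices.

(** * Descent to the quotients by the relations *)

Section Kernels.
Variable C : fieldType.
Implicit Types (w : ratfun C).

Lemma T_yrel w x : yrel x -> T w x = 0.
Proof.
exact: (yrel_kernel (f := T w) (T_var w) (eval_gen_yrelations w)).
Qed.

(* Here and below, images of elements are composed as explicit equations:
   rewriting under TT would compare distinct elements of the free algebra by
   conversion, which diverges. *)
Lemma TT_yten w w' x y : TT w w' (yten x y) =
  gtens par2 par2 (T w x) 1%:M *m gtens par2 par2 1%:M (T w' y).
Proof.
exact: etrans (TTM _ _ (leg1 x) (leg2 y))
  (f_equal2 *%R (TT_leg1 _ _ _) (TT_leg2 _ _ _)).
Qed.

(** Relations on a single leg vanish because [T] is a representation, cross relations because the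
    generators act homogeneously. *)
Lemma TT_yyideal serre w w' x :
  (forall y, serre y -> forall w, T w y = 0) -> yyideal serre x ->
  TT w w' x = 0.
Proof.
move=> serreT; suff: forall y, yyrel serre y -> TT w w' y = 0.
  by move=> H; exact: (ideal_kernel (f := TT w w') H).
have T0 v y : yrel y \/ serre y -> T v y = 0 by case=> [/T_yrel|/serreT]; apply.
move=> {}x [y /(T0 w) y0|y /(T0 w') y0|g h].
- by rewrite TT_leg1 y0 -(scale0r 1%:M) gtensZl scale0r.
- by rewrite TT_leg2 y0 -(scale0r 1%:M) gtensZr scale0r.
- have fl : TT w w' (leg2 (fvar _ h) * leg1 (fvar _ g)) =
      gtens par2 par2 1%:M (T_gen w' h) *m gtens par2 par2 (T_gen w g) 1%:M.
    apply: etrans (TTM _ _ (leg2 _) (leg1 _)) _.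
    apply: etrans (f_equal2 *%R (TT_leg2 _ _ _) (TT_leg1 _ _ _)) _.
    by rewrite [T w' _]T_var [T w _]T_var.
  have fr (n : bool) : TT w w' ((-1) ^+ n * yten (fvar _ g) (fvar _ h)) =
      (-1) ^+ n *: (gtens par2 par2 (T_gen w g) 1%:M *m
                    gtens par2 par2 1%:M (T_gen w' h)).
    apply: etrans (TTM _ _ _ (yten _ _)) _.
    apply: etrans (f_equal2 *%R (rmorph_sign _ _) (TT_yten _ _ _ _)) _.
    by rewrite [T w' _]T_var [T w _]T_var scaler_sign mulr_sign.
  rewrite TTD TTN; apply: etrans (f_equal2 (fun a b => a - b) fl (fr _)) _.
  by rewrite (mul_gtens_cross (@T_gen_homog _ w g) (@T_gen_homog _ w' h)) subrr.
Qed.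

Lemma rconst_sgn_half b : rconst ((sgn {poly C} b * Defs.half C) * 'X).[1] =
  sgn (ratfun C) b * rconst 2%:R^-1.
Proof.
rewrite /rconst /Defs.half /sgn hornerM hornerX mulr1 hornerM hornerC.
by case: b; rewrite ?expr0 ?expr1 ?hornerN hornerC ?polyCN !rmorphM ?rmorphN
  ?rmorph1.
Qed.

Lemma T1 w : T w 1 = 1%:M. Proof. exact: rmorph1. Qed.
Lemma TTB w w' : {morph TT w w' : a b / a - b}. Proof. exact: rmorphB. Qed.

Lemma TT_coproduct_var w s g : TT w s (coproduct (fvar _ g)) =
  tensor_gen w s (rconst 2%:R^-1) g.
Proof.
rewrite coproduct_var tensor_genE /coproduct_gen.
have ytE g1 g2 : TT w s (yten (fvar _ g1) (fvar _ g2)) =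
    gtens par2 par2 (T_gen w g1) 1%:M *m gtens par2 par2 1%:M (T_gen s g2).
  apply: etrans (TT_yten _ _ _ _) _.
  exact: (f_equal2 (fun A B => gtens par2 par2 A 1%:M *m gtens par2 par2 1%:M B)
            (T_var _ _) (T_var _ _)).
have primE g' : TT w s (yten (fvar _ g') 1 + yten 1 (fvar _ g')) =
    gtens par2 par2 (T_gen w g') 1%:M + gtens par2 par2 1%:M (T_gen s g').
  apply: etrans (TTD _ _ (yten _ _) (yten _ _)) _.
  apply: (f_equal2 +%R); apply: etrans (TT_yten _ _ _ _) _.
    by rewrite [T w _]T_var [T s _]T1 gtens11 mulmx1.
  by rewrite [T s _]T_var [T w _]T1 gtens11 mul1mx.
have subE a b A B : TT w s a = A -> TT w s b = B -> TT w s (a - b) = A - B.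
  by move=> <- <-; exact: TTB.
have scaleE p c a A : rconst p.[1] = c -> TT w s a = A ->
    TT w s (p *: a) = c *: A.
  by move=> <- <-; exact: TTZ.
case: g => [[b||] []]; rewrite ?subr0; try exact: primE.
- apply: (subE _ _ _ _ (primE _)); apply: scaleE; first exact: rconst_sgn_half.
  exact: (subE _ _ _ _ (ytE (gE b, false) (gH, false)) (ytE _ _)).
- apply: (subE _ _ _ _ (primE _)); rewrite -[X in _ = X]scale1r.
  apply: scaleE; first by rewrite hornerX /rconst rmorph1.
  apply: etrans (TTD _ _ (yten _ _) (yten _ _)) _.
  exact: (f_equal2 +%R (ytE (gE true, false) (gE false, false)) (ytE _ _)).
Qed.

End Kernels.

(** * Existence of the intertwiner *)

Section Intertwiner.
Variable F : fieldType.
Implicit Types (w s h u a c x z : F).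

Lemma two_half h : h + h = 1 -> 2%:R != 0 :> F /\ h = 2%:R^-1.
Proof.
move=> hh; have h2 : h * 2%:R = 1 by rewrite mulr_natr mulr2n.
have t0 : 2%:R != 0 :> F.
  by apply: contra_eq_neq h2 => ->; rewrite mulr0 eq_sym oner_eq0.
by split=> //; rewrite -[LHS](mulfK t0) h2 mul1r.
Qed.

(** The operator a + c P, with P the graded flip; see [flip_span_K_mx]. *)
Definition K_mx a c : 'M[F]_4 :=
  smx 4 [:: [:: a + c; 0; 0; 0]; [:: 0; a; c; 0]; [:: 0; c; a; 0];
            [:: 0; 0; 0; a - c]].

Definition tensor_twE w s h (b : bool) : 'M[F]_4 :=
  let g := tensor_gen w s h in
  (sgn F b * h) *:
    (comm (g (gH2, true)) (g (gE b, true)) +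
     (g (gE b, false) * g (gH, true) - g (gE b, true) * g (gH, false))).

(** The twisted generator acts again by a combination of [E^b (x) 1] and [1 (x) E^b], so its
    intertwining can be compared with that of the level-zero generators. *)
Lemma tensor_twEE w s h b : h + h = 1 ->
  tensor_twE w s h b =
  odd_mx b (w ^+ 2 - sgn F b * w + h ^+ 2) (s ^+ 2 + sgn F b * w - 1 + h ^+ 2).
Proof.
move=> /two_half[t0 ->].
rewrite /tensor_twE /comm -!mulmxE; case: b; rewrite /sgn /odd_mx /=;
  smx_eq; rewrite ?(expr0, expr1, mul0r, mulr0, addr0, add0r, oppr0) //.
all: by field.
Qed.

Lemma K_mx_H2 a c : H2_mx F *m K_mx a c = K_mx a c *m H2_mx F.
Proof. by rewrite /H2_mx; smx_eq; ring. Qed.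

Lemma K_mx_E b a c : odd_mx b 1 1 *m K_mx a c = K_mx a c *m odd_mx b 1 1.
Proof. by case: b; rewrite /odd_mx; smx_eq; ring. Qed.

(** The terms in [h ^+ 2] contribute the same multiple of [odd_mx b 1 1] on both sides, which
    commutes with a + c P; the other terms give the condition on a and c. *)
Lemma K_mx_twE b u s h :
  let K := K_mx (u ^+ 2 - (s ^+ 2 - 1)) (2%:R * u) in
  odd_mx b ((- u) ^+ 2 - sgn F b * - u + h ^+ 2)
           (s ^+ 2 + sgn F b * - u - 1 + h ^+ 2) *m K =
  K *m odd_mx b (u ^+ 2 - sgn F b * u + h ^+ 2)
           (s ^+ 2 + sgn F b * u - 1 + h ^+ 2).
Proof.
case: b; rewrite /sgn /odd_mx /K_mx /=; smx_eq;
  rewrite ?(expr0, expr1, mul0r, mulr0, addr0, add0r, oppr0) //; ring.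
Qed.

End Intertwiner.

(** * The reflection equation in the group algebra of S_3 *)

Section SymmetricGroupAlgebra.
Variables (F : comNzRingType) (A : algType F) (a b c : A).
Hypotheses (aa : a * a = 1) (cc : c * c = 1).
Hypotheses (aca : a * c * a = b) (cac : c * a * c = b).

(* The image of F[S_3] in A; a, b and c are the transpositions. *)
Definition s3 (d0 d1 d2 d3 d4 d5 : F) : A :=
  d0 *: 1 + d1 *: a + d2 *: b + d3 *: c + d4 *: (c * a) + d5 *: (a * c).

(** Left multiplication by a transposition permutes the six group elements, hence the
    coefficients. *)
Lemma mul_a_s3 d0 d1 d2 d3 d4 d5 :
  a * s3 d0 d1 d2 d3 d4 d5 = s3 d1 d0 d4 d5 d2 d3.
Proof.
rewrite /s3 !mulrDr -!scalerAr mulr1 aa.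
have -> : a * b = c * a by rewrite -aca !mulrA aa mul1r.
have -> : a * (c * a) = b by rewrite mulrA aca.
have -> : a * (a * c) = c by rewrite mulrA aa mul1r.
by rewrite [LHS](+%R.[ACl 2*1*5*6*3*4]).
Qed.

Lemma mul_c_s3 d0 d1 d2 d3 d4 d5 :
  c * s3 d0 d1 d2 d3 d4 d5 = s3 d3 d4 d5 d0 d1 d2.
Proof.
rewrite /s3 !mulrDr -!scalerAr mulr1 cc.
have -> : c * b = a * c by rewrite -cac !mulrA cc mul1r.
have -> : c * (c * a) = a by rewrite mulrA cc mul1r.
have -> : c * (a * c) = b by rewrite mulrA cac.
by rewrite [LHS](+%R.[ACl 4*5*6*1*2*3]).
Qed.

Lemma mul_b_s3 d0 d1 d2 d3 d4 d5 :
  b * s3 d0 d1 d2 d3 d4 d5 = s3 d2 d5 d0 d4 d3 d1.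
Proof. by rewrite -cac -!mulrA mul_c_s3 mul_a_s3 mul_c_s3. Qed.

Lemma s3D d0 d1 d2 d3 d4 d5 e0 e1 e2 e3 e4 e5 :
  s3 d0 d1 d2 d3 d4 d5 + s3 e0 e1 e2 e3 e4 e5 =
  s3 (d0 + e0) (d1 + e1) (d2 + e2) (d3 + e3) (d4 + e4) (d5 + e5).
Proof. by rewrite /s3 !scalerDl; do 5![rewrite addrACA; congr (_ + _)]. Qed.

Lemma s3Z k d0 d1 d2 d3 d4 d5 :
  k *: s3 d0 d1 d2 d3 d4 d5 =
  s3 (k * d0) (k * d1) (k * d2) (k * d3) (k * d4) (k * d5).
Proof. by rewrite /s3 !scalerDr !scalerA. Qed.

(** [a], [b] and [c] stand for (12), (13) and (23); [R] is taken without its normalising scalar. *)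
Lemma s3_reflection (u v t : F) :
  let K w x := (w ^+ 2 - t) *: 1 + (2%:R * w) *: x in
  let R w := w *: 1 + 1 *: a in
  R (u - v) * K u b * R (u + v) * K v c = K v c * R (u + v) * K u b * R (u - v).
Proof.
have mulE k l x d0 d1 d2 d3 d4 d5 : (k *: 1 + l *: x) * s3 d0 d1 d2 d3 d4 d5 =
    k *: s3 d0 d1 d2 d3 d4 d5 + l *: (x * s3 d0 d1 d2 d3 d4 d5).
  by rewrite mulrDl -!scalerAl mul1r.
have oneE : 1 = s3 1 0 0 0 0 0 by rewrite /s3 scale1r !scale0r !addr0.
have s3_inj x y : x * s3 1 0 0 0 0 0 = y * s3 1 0 0 0 0 0 -> x = y.
  by rewrite -oneE !mulr1.
(* Both sides are applied to the unit in its [s3] form, so that the factors act from right to left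
   on six coefficients. *)
apply: s3_inj; rewrite /= -!mulrA.
rewrite !(mulE, mul_a_s3, mul_b_s3, mul_c_s3, s3Z, s3D).
congr s3; ring.
Qed.
End SymmetricGroupAlgebra.

(** * The action of S_3 on the triple graded tensor product *)

Section GradedFlip.

(* Matrices given by functions on nat, so that identities between graded
   permutation matrices can be decided by computation over int. *)
Definition flip_entry (F : pzRingType) (a b : nat) : F :=
  (-1) ^+ (odd (b %/ 2) && odd (b %% 2))%N *
  ((a %/ 2 == b %% 2) && (a %% 2 == b %/ 2))%N%:R.

Lemma gflipE (F : nzRingType) : gflip F = fmx 4 (flip_entry F).
Proof. by apply/matrixP=> a b; rewrite !mxE. Qed.

Definition flip12_entry (F : nzRingType) (a b : nat) : F :=
  (-1) ^+ ((odd (a %% 2) (+) odd (b %% 2)) &&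
           (odd (b %/ 2 %/ 2) (+) odd (b %/ 2 %% 2)))%N *
  (flip_entry F (a %/ 2)%N (b %/ 2)%N * (a %% 2 == b %% 2)%N%:R).

Definition flip23_entry (F : nzRingType) (a b : nat) : F :=
  (-1) ^+ ((odd (a %% 4 %/ 2) (+) odd (a %% 4 %% 2)
            (+) (odd (b %% 4 %/ 2) (+) odd (b %% 4 %% 2))) &&
           odd (b %/ 4))%N *
  ((a %/ 4 == b %/ 4)%N%:R * flip_entry F (a %% 4)%N (b %% 4)%N).

Lemma op12_gflip (F : nzRingType) :
  op12 (gflip F) = fmx 8 (flip12_entry F).
Proof. by apply/matrixP=> a b; rewrite mxE /= !mxE. Qed.

Lemma op23_gflip (F : nzRingType) :
  op23 (gflip F) = fmx 8 (flip23_entry F).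
Proof. by apply/matrixP=> a b; rewrite mxE /= !mxE. Qed.

Lemma fmx_int (F : nzRingType) n (f : nat -> nat -> F) (g : nat -> nat -> int) :
  (forall i j, f i j = (g i j)%:~R) -> fmx n f = map_mx intr (fmx n g).
Proof. by move=> fg; apply/matrixP=> i j; rewrite !mxE fg. Qed.

Lemma flip12_int (F : nzRingType) :
  op12 (gflip F) = map_mx intr (fmx 8 (flip12_entry int)).
Proof.
rewrite op12_gflip; apply: fmx_int => i j.
by rewrite /flip12_entry /flip_entry !rmorphM !rmorph_sign !rmorph_nat.
Qed.

Lemma flip23_int (F : nzRingType) :
  op23 (gflip F) = map_mx intr (fmx 8 (flip23_entry int)).
Proof.
rewrite op23_gflip; apply: fmx_int => i j.
by rewrite /flip23_entry /flip_entry !rmorphM !rmorph_sign !rmorph_nat.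
Qed.

Lemma eq_fmx_int n (f g : nat -> nat -> int) :
  all (fun i => all (fun j => f i j == g i j) (iota 0 n)) (iota 0 n) ->
  fmx n f = fmx n g.
Proof.
move=> /allP fg; apply/matrixP=> i j; rewrite !mxE; apply/eqP.
have /fg/allP : (i : nat) \in iota 0 n by rewrite mem_iota ltn_ord.
by apply; rewrite mem_iota ltn_ord.
Qed.

Lemma flip12_sq (F : nzRingType) : op12 (gflip F) *m op12 (gflip F) = 1%:M.
Proof.
rewrite flip12_int -map_mxM fmxM -(map_mx1 intr); congr map_mx.
transitivity (fmx 8 (fun i j => (i == j)%:R : int)).
  by apply: eq_fmx_int; vm_compute.
by apply/matrixP=> i j; rewrite !mxE.
Qed.

Lemma flip23_sq (F : nzRingType) : op23 (gflip F) *m op23 (gflip F) = 1%:M.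
Proof.
rewrite flip23_int -map_mxM fmxM -(map_mx1 intr); congr map_mx.
transitivity (fmx 8 (fun i j => (i == j)%:R : int)).
  by apply: eq_fmx_int; vm_compute.
by apply/matrixP=> i j; rewrite !mxE.
Qed.

(** The right side is by definition [op13 (gflip F)], the transposition (13). *)
Lemma flip_braid (F : nzRingType) (A := op12 (gflip F)) (B := op23 (gflip F)) :
  A *m B *m A = B *m A *m B.
Proof.
rewrite /A /B flip12_int flip23_int -!map_mxM !fmxM; congr map_mx.
by apply: eq_fmx_int; vm_compute.
Qed.

End GradedFlip.

(** * The reflection equation for operators in the span of 1 and P *)

Section Reflection.
Variable F : fieldType.
Implicit Types (u v t x y r : F) (M : 'M[F]_4).

(* The R-matrix and the K-matrix both lie in the span of 1 and P. *)
Definition flip_span x y : 'M[F]_4 := x *: 1%:M + y *: gflip F.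

Lemma Rmatrix_flip u :
  Rmatrix u = flip_span (u / (u + 1)) (1 - u / (u + 1)).
Proof.
rewrite /Rmatrix /flip_span gflipE; move: (u / (u + 1)) => r.
by apply/matrixP=> -[[|[|[|[|?]]]] ?] [[|[|[|[|?]]]] ?] //;
  rewrite !mxE /flip_entry /=; ring.
Qed.

Lemma Rmatrix_scale u : u + 1 != 0 -> Rmatrix u = (u + 1)^-1 *: flip_span u 1.
Proof.
move=> u1; rewrite Rmatrix_flip /flip_span scalerDr !scalerA mulrC mulr1.
by congr (_ + _ *: _); field.
Qed.

Lemma op12_span x y :
  op12 (flip_span x y) = x *: 1 + y *: op12 (gflip F).
Proof. by rewrite /op12 /flip_span gtensDl !gtensZl gtens11. Qed.

Lemma op23_span x y :
  op23 (flip_span x y) = x *: 1 + y *: op23 (gflip F).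
Proof. by rewrite /op23 /flip_span gtensDr !gtensZr gtens11. Qed.

(** Conjugation by the flip of the last two factors fixes the unit because that flip is an
    involution. *)
Lemma op13_span x y :
  op13 (flip_span x y) = x *: 1 + y *: op13 (gflip F).
Proof.
rewrite /op13 op12_span mulmxDr mulmxDl -!scalemxAr -!scalemxAl.
by congr (_ *: _ + _); rewrite mulmx1 flip23_sq.
Qed.

Lemma op12Z x M : op12 (x *: M) = x *: op12 M.
Proof. by rewrite /op12 gtensZl. Qed.

Lemma flip_span_reflection u v t :
    u - v + 1 != 0 -> u + v + 1 != 0 ->
  let R w := op12 (Rmatrix w) in
  let K w := flip_span (w ^+ 2 - t) (2%:R * w) in
  R (u - v) *m op13 (K u) *m R (u + v) *m op23 (K v) =
  op23 (K v) *m R (u + v) *m op13 (K u) *m R (u - v).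
Proof.
move=> uv0 uv1 /=; rewrite !Rmatrix_scale // !op12Z.
(* [R] occurs once at u - v and once at u + v on each side, so the normalising scalars agree up to
   order. *)
rewrite -!(scalemxAl, scalemxAr) !scalerA mulrC; congr (_ *: _).
rewrite !op12_span op13_span op23_span.
exact: (@s3_reflection F 'M[F]_8 _ _ _ (flip12_sq F) (flip23_sq F)
  (flip_braid F) erefl u v t).
Qed.

End Reflection.

(** * Substitution of u and v in rational functions *)

Section Substitution.
Variable C : fieldType.

Definition eval2 (w : ratfun2 C) (p : {poly C}) : ratfun2 C :=
  (map_poly (@tofrac _ \o polyC \o polyC) p).[w].

(** [rsubst] evaluates the representative n / d picked by [repr]. Its equivalence with p / 1 gives p
    d = n, and the hypothesis on [w] lets the value of d be cancelled. *)
Lemma rsubst_tofrac (w : ratfun2 C) (p : {poly C}) :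
  (forall q, q != 0 -> eval2 w q != 0) -> rsubst w (tofrac p) = eval2 w p.
Proof.
move=> w_tr; have := FracField.equivf_r (Ratio p 1).
rewrite !numden_Ratio ?oner_neq0 // mul1r.
have -> : \pi_(FracField.type {poly C})%qT (Ratio p 1) = tofrac p.
  by rewrite piE.
set f := tofrac p => pd; rewrite /rsubst -/(eval2 w _) -/(eval2 w _) -pd.
have dn0 : eval2 w \d_(repr f) != 0 by apply: w_tr; exact: denom_ratioP.
by rewrite {1}/eval2 rmorphM hornerM mulfK.
Qed.

(** [u] is the inner variable of [{poly {poly C}}], so the result is constant in the outer variable
    [v]. *)
Lemma eval2_uvar (q : {poly C}) : eval2 (uvar C) q = tofrac q%:P.
Proof.
rewrite /eval2 /uvar !map_poly_comp !horner_map.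
by rewrite -[(_).['X]]/(q \Po 'X) comp_polyXr.
Qed.

Lemma eval2_vvar (q : {poly C}) : eval2 (vvar C) q = tofrac (map_poly polyC q).
Proof.
rewrite /eval2 /vvar !map_poly_comp horner_map.
by rewrite -[(_).['X]]/(map_poly polyC q \Po 'X) comp_polyXr.
Qed.

Lemma eval2_uvar_neq0 (q : {poly C}) : q != 0 -> eval2 (uvar C) q != 0.
Proof. by rewrite eval2_uvar tofrac_eq0 polyC_eq0. Qed.

Lemma eval2_vvar_neq0 (q : {poly C}) : q != 0 -> eval2 (vvar C) q != 0.
Proof. by rewrite eval2_vvar tofrac_eq0 map_polyC_eq0. Qed.

Lemma uv_neq0 : uvar C - vvar C + 1 != 0 /\ uvar C + vvar C + 1 != 0.
Proof.
rewrite /uvar /vvar -(rmorph1 (@tofrac {poly {poly C}})) -rmorphB -!rmorphD.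
(* Setting v = 0 leaves ['X + 1], which has size 2. *)
rewrite !tofrac_eq0; split; apply/eqP => /(congr1 (horner^~ 0));
  rewrite !hornerE => /eqP.
all: by rewrite ?subr0 -size_poly_eq0 -polyC1 size_XaddC.
Qed.

(** The K-matrix with polynomial entries, to which [rsubst_tofrac] applies. Here [t] is later set to
    [s ^+ 2 - 1]; it is not the parameter of the twisted Yangian. *)
Definition K_poly (t : C) : 'M[{poly C}]_4 :=
  ('X ^+ 2 - t%:P) *: 1%:M + (2%:R * 'X) *: gflip {poly C}.

Lemma map_gflip (R S : nzRingType) (f : {rmorphism R -> S}) :
  map_mx f (gflip R) = gflip S.
Proof.
by apply/matrixP=> i j; rewrite !mxE /= rmorphM rmorph_sign rmorph_nat.
Qed.

Lemma map_K_poly (S : fieldType) (f : {rmorphism {poly C} -> S}) t :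
  map_mx f (K_poly t) =
  flip_span ((f 'X) ^+ 2 - f t%:P) (2%:R * f 'X).
Proof.
rewrite /K_poly /flip_span map_mxD !map_mxZ map_mx1 map_gflip rmorphB rmorphXn.
by rewrite rmorphM rmorph_nat.
Qed.

End Substitution.

(** * Uniqueness of the intertwiner *)

Section Uniqueness.
Variable F : fieldType.
Implicit Types (x z a c w s h u : F) (K : 'M[F]_4).

Lemma mx4E K : K = smx 4 (lmx 4 (fun i j => K (inord i) (inord j))).
Proof. by rewrite smx_lmx; apply/matrixP=> i j; rewrite !mxE !inord_val. Qed.

Lemma smx4_inj (L M : seq (seq F)) : smx 4 L = smx 4 M ->
  forall i j, (i < 4)%N -> (j < 4)%N -> lentry L i j = lentry M i j.
Proof.
move=> LM i j i4 j4.
by have /matrixP/(_ (Ordinal i4) (Ordinal j4)) := LM; rewrite !mxE.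
Qed.

(** Lets [ring] deduce a relation between unknown entries from a known entry equation. *)
Lemma eq_of_sub (l r x y : F) : l = r -> x - y = l - r -> x = y.
Proof. by move=> -> /eqP; rewrite subrr subr_eq0 => /eqP. Qed.

Ltac entry e :=
  apply: (eq_of_sub e); rewrite /lmx /mkseq /fmul /lentry /=; ring.

(** [H_2] has weights 2, 0, 0, -2, so all entries between different weights vanish; commuting with
    [E^+] and [E^-] ties the rest to the entries (1,1) and (1,2). *)
Lemma commute_K_mx K : 2%:R != 0 :> F ->
    H2_mx F *m K = K *m H2_mx F ->
    (forall b, odd_mx b 1 1 *m K = K *m odd_mx b 1 1) ->
  exists a c, K = K_mx a c.
Proof.
move=> t0 H2 HE.
have t0M (y : F) : 2%:R * y = 0 -> y = 0.
  by move=> /eqP; rewrite mulf_eq0 (negPf t0) => /eqP.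
move: (HE true) (HE false) H2; rewrite (mx4E K).
move: (fun i j : nat => K _ _) => k.
rewrite /odd_mx /H2_mx !smxM => /smx4_inj eT /smx4_inj eF /smx4_inj e2.
have k01 : k 0 1 = 0 by apply: t0M; entry (e2 0 1 isT isT).
have k02 : k 0 2 = 0 by apply: t0M; entry (e2 0 2 isT isT).
have k13 : k 1 3 = 0 by apply: t0M; entry (e2 1 3 isT isT).
have k23 : k 2 3 = 0 by apply: t0M; entry (e2 2 3 isT isT).
have k10 : k 1 0 = 0 by apply: t0M; entry (esym (e2 1 0 isT isT)).
have k20 : k 2 0 = 0 by apply: t0M; entry (esym (e2 2 0 isT isT)).
have k31 : k 3 1 = 0 by apply: t0M; entry (esym (e2 3 1 isT isT)).
have k32 : k 3 2 = 0 by apply: t0M; entry (esym (e2 3 2 isT isT)).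
(* The weights now differ by 4, so a factor 2 is cancelled twice. *)
have k03 : k 0 3 = 0 by apply/t0M/t0M; entry (e2 0 3 isT isT).
have k30 : k 3 0 = 0 by apply/t0M/t0M; entry (esym (e2 3 0 isT isT)).
have k00 : k 0 0 = k 1 1 + k 1 2 by entry (eF 1 0 isT isT).
have k33 : k 3 3 = k 1 1 - k 1 2 by entry (eT 1 3 isT isT).
have k21 : k 2 1 = k 0 0 - k 1 1 by entry (eT 0 1 isT isT).
have k22 : k 2 2 = k 0 0 - k 1 2 by entry (eT 0 2 isT isT).
exists (k 1 1), (k 1 2).
rewrite /K_mx /lmx /mkseq /= k33 k21 k22 k00 k01 k02 k13 k23 k10 k20 k31 k32.
by rewrite k03 k30 [k 1 1 + _ - _]addrAC subrr add0r addrK.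
Qed.

Lemma K_mxZ x a c : x *: K_mx a c = K_mx (x * a) (x * c).
Proof. by rewrite /K_mx; smx_eq; ring. Qed.

Lemma K_mx_neq0 a c : c != 0 -> K_mx a c != 0.
Proof.
apply: contraNneq => /matrixP/(_ (inord 1) (inord 2)).
by rewrite !mxE /lentry !inordK //= => ->.
Qed.

(** Once [K] is a + c P, the entry (0,1) of the last relation reads 2 u a = (u^2 - s^2 + 1) c, so c
    determines a and the scalar is c / (2 u). *)
Lemma K_mx_unique K u s h : 2%:R != 0 :> F -> u != 0 ->
    H2_mx F *m K = K *m H2_mx F ->
    (forall b, odd_mx b 1 1 *m K = K *m odd_mx b 1 1) ->
    odd_mx true ((- u) ^+ 2 - sgn F true * - u + h ^+ 2)
                (s ^+ 2 + sgn F true * - u - 1 + h ^+ 2) *m K =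
    K *m odd_mx true (u ^+ 2 - sgn F true * u + h ^+ 2)
                     (s ^+ 2 + sgn F true * u - 1 + h ^+ 2) ->
  exists k, K = k *: K_mx (u ^+ 2 - (s ^+ 2 - 1)) (2%:R * u).
Proof.
move=> t0 u0 H2 HE; have [a [c ->]] := commute_K_mx t0 H2 HE.
rewrite /odd_mx /K_mx !smxM => /smx4_inj e; exists (c / (2%:R * u)).
have ac : 2%:R * u * a = c * (u ^+ 2 - (s ^+ 2 - 1)).
  apply: (eq_of_sub (esym (e 0 1 isT isT))).
  by rewrite /lmx /mkseq /fmul /lentry /sgn expr0 /=; ring.
have tu0 : 2%:R * u != 0 by rewrite mulf_neq0.
rewrite -/(K_mx _ _) K_mxZ divfK //; congr K_mx.
by rewrite mulrAC -ac mulrC mulKf.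
Qed.

Lemma flip_span_K_mx a c : flip_span a c = K_mx a c.
Proof.
rewrite /flip_span /K_mx gflipE.
by apply/matrixP=> -[[|[|[|[|?]]]] ?] [[|[|[|[|?]]]] ?] //;
  rewrite !mxE /flip_entry /lentry /=; ring.
Qed.
End Uniqueness.

(** * Intertwining on a generated subalgebra *)

Section SubalgebraIntertwiner.
Variables (K : nzRingType) (A : lalgType K) (B : nzRingType).
Variables (f g : {rmorphism A -> B}) (M : B).

Lemma subalg_intertwine (S : A -> Prop) :
    (forall c : K, f c%:A * M = M * g c%:A) ->
    (forall x, S x -> f x * M = M * g x) ->
  forall x, subalg S x -> f x * M = M * g x.
Proof.
move=> fgK fgS x; elim=> {x} [x /fgS //|//|x y _ fx _ fy|x y _ fx _ fy].
  by rewrite !rmorphD mulrDl mulrDr fx fy.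
by rewrite !rmorphM -mulrA fy mulrA fx mulrA.
Qed.

Lemma acomm_intertwine (x y x' y' : B) :
  x * M = M * x' -> y * M = M * y' -> acomm x y * M = M * acomm x' y'.
Proof.
move=> xM yM; rewrite /acomm mulrDl mulrDr -!mulrA xM yM.
by rewrite !(mulrA _ M) xM yM !mulrA.
Qed.
End SubalgebraIntertwiner.

(** * Intertwiners of the twisted Yangian *)

Section TwistedYangian.
Variable C : fieldType.
Hypothesis two_neq0 : 2%:R != 0 :> C.
Variables (s : C) (serre : Y C -> Prop).
Hypothesis serreP : serre_compatible serre.

Local Notation h := (rconst (2%:R^-1 : C)).
Local Notation tg w := (tensor_gen w (rconst s) h).
Local Notation twM w := (tensor_twE w (rconst s) h).

Definition phi (w : ratfun C) : {rmorphism Y C -> 'M[ratfun C]_4} :=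
  TT w (rconst s) \o @coproduct C.

Lemma phi_def w x : TT w (rconst s) (coproduct x) = phi w x.
Proof. by []. Qed.

Lemma phi_var w g : phi w (fvar _ g) = tg w g.
Proof. exact: TT_coproduct_var. Qed.

Lemma phi_E w b : phi w (yE C b) = odd_mx b 1 1.
Proof. by rewrite phi_var; case: b. Qed.

Lemma phi_H2 w : phi w (yH2 C) = H2_mx _.
Proof. by rewrite phi_var. Qed.

Lemma phiZ w p x : phi w (p *: x) = rconst p.[1] *: phi w x.
Proof. by rewrite /phi /= coproductZ TTZ. Qed.

Lemma rconst_half : h + h = 1.
Proof.
rewrite /rconst -rmorphD -polyCD -[RHS](rmorph1 (@tofrac _)) -polyC1.
by congr (tofrac _%:P); field.
Qed.

Lemma phi_scalar w (c : {poly C}) : phi w c%:A = (rconst c.[1])%:M.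
Proof. by rewrite phiZ rmorph1 scalemx1. Qed.

(** Makes intertwining independent of representatives. Explicit relations vanish by the matrix
    check, Serre relations because [TT] kills the ideal containing their coproducts. *)
Lemma phi_yideal w x : yideal serre x -> phi w x = 0.
Proof.
apply: ideal_kernel => {}x [].
  exact: (yrel_kernel (phi_var w) (tensor_gen_yrelations _ _ rconst_half)).
case: serreP => coserre serreT /coserre.
exact: TT_yyideal.
Qed.

Lemma phi_twE w b : phi w (twE 0 b) = twM w b.
Proof.
have addE x y X Z : phi w x = X -> phi w y = Z -> phi w (x + y) = X + Z.
  by move=> <- <-; exact: rmorphD.
have subE x y X Z : phi w x = X -> phi w y = Z -> phi w (x - y) = X - Z.
  by move=> <- <-; exact: rmorphB.
have mulE x y X Z : phi w x = X -> phi w y = Z -> phi w (x * y) = X * Z.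
  by move=> <- <-; exact: rmorphM.
have scaleE p c x X : rconst p.[1] = c -> phi w x = X ->
    phi w (p *: x) = c *: X.
  by move=> <- <-; exact: phiZ.
apply/scaleE.
  have := rconst_sgn_half C b; rewrite hornerM hornerX mulr1 => ->.
  by [].
apply/addE.
  exact: (rmorph_commutator (f := phi w) (phi_var w _) (phi_var w _)).
rewrite -[X in _ = X]scale1r; apply/scaleE.
  by rewrite hornerX /rconst rmorph1.
apply: subE; last exact: (mulE _ _ _ _ (phi_var w _) (phi_var w _)).
(* The added zero matches the summand with coefficient [t], which is 0 here. *)
rewrite -[X in _ = X]add0r; apply: addE.
  rewrite -(scale0r (phi w (yEh C b))); apply: scaleE => //.
  by rewrite mulr0 horner0 /rconst rmorph0.
exact: (mulE _ _ _ _ (phi_var w _) (phi_var w _)).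
Qed.

(** Intertwining passes from generators to the subalgebra. Of the generators missing from the list,
    [H] acts by the scalar 2 and [twH] is an anticommutator of listed ones. *)
Lemma intertwinesP (K : 'M[ratfun C]_4) :
  intertwines (twisted_yangian serre 0) s K <->
  [/\ H2_mx _ *m K = K *m H2_mx _,
      forall b, odd_mx b 1 1 *m K = K *m odd_mx b 1 1 &
      forall b, twM (- rvar C) b *m K = K *m twM (rvar C) b].
Proof.
split=> [Kint|[KH2 KE Ktw] x [y ySub xy]].
  have Kgen x X X' : twgen 0 x -> phi (- rvar C) x = X -> phi (rvar C) x = X' ->
      X *m K = K *m X'.
    move=> xg <- <-; apply: Kint; exists x; first exact: subalg_gen.
    by rewrite subrr; exact: ideal0.
  split=> [|b|b].
  - exact: (Kgen _ _ _ (twgen_H2 _) (phi_H2 _) (phi_H2 _)).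
  - exact: (Kgen _ _ _ (twgen_E _ b) (phi_E _ _) (phi_E _ _)).
  - exact: (Kgen _ _ _ (twgen_twE _ b) (phi_twE _ _) (phi_twE _ _)).
have phiE w : TT w (rconst s) (coproduct x) = phi w y.
  rewrite phi_def; apply/eqP; rewrite -subr_eq0 -rmorphB; apply/eqP.
  exact: phi_yideal.
suff yM : phi (- rvar C) y * K = K * phi (rvar C) y.
  exact: (etrans (f_equal (mulmx^~ K) (phiE (- rvar C)))
           (etrans yM (esym (f_equal (mulmx K) (phiE (rvar C)))))).
have gen z X X' : phi (- rvar C) z = X -> phi (rvar C) z = X' ->
    X *m K = K *m X' -> phi (- rvar C) z * K = K * phi (rvar C) z.
  move=> zX zX' XK; exact: (etrans (f_equal (fun Z => Z *m K) zX)
    (etrans XK (esym (f_equal (mulmx K) zX')))).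
have KEb b := gen _ _ _ (phi_E _ _) (phi_E _ _) (KE b).
have Ktwb b := gen _ _ _ (phi_twE _ _) (phi_twE _ _) (Ktw b).
apply: subalg_intertwine ySub => [c|_ [b|||b|b]].
- by apply: (gen _ _ _ (phi_scalar _ _) (phi_scalar _ _)); rewrite scalar_mxC.
- exact: KEb.
- by apply: (gen _ _ _ (phi_var _ _) (phi_var _ _)); rewrite scalar_mxC.
- exact: (gen _ _ _ (phi_H2 _) (phi_H2 _) KH2).
- exact: Ktwb.
- have twHE w : phi w (twH 0 b) = acomm (phi w (yE C b)) (phi w (twE 0 (~~ b))).
    exact: rmorph_anticommutator.
  have := acomm_intertwine (KEb b) (Ktwb (~~ b)).
  exact: (gen _ _ _ (twHE _) (twHE _)).
Qed.

Lemma eval2_K_poly (w : ratfun2 C) (t : C) :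
  (forall q, q != 0 -> eval2 w q != 0) ->
  map_mx (rsubst w) (map_mx (@tofrac _) (K_poly t)) =
  flip_span (w ^+ 2 - tofrac t%:P%:P) (2%:R * w).
Proof.
move=> w_tr.
pose ev : {rmorphism {poly C} -> ratfun2 C} :=
  horner_eval w \o map_poly (@tofrac _ \o polyC \o polyC).
transitivity (map_mx ev (K_poly t)).
  by apply/matrixP=> i j; rewrite [LHS]mxE [X in rsubst _ X]mxE rsubst_tofrac //
    [RHS]mxE.
rewrite map_K_poly /ev /= /horner_eval map_polyX map_polyC !hornerE.
by [].
Qed.

Lemma K_reflection (t : C) :
  reflection_equation (map_mx (@tofrac _) (K_poly t)).
Proof.
rewrite /reflection_equation !eval2_K_poly; last first.
- exact: eval2_uvar_neq0.
- exact: eval2_vvar_neq0.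
have [uv0 uv1] := uv_neq0 C.
exact: (flip_span_reflection (tofrac t%:P%:P) uv0 uv1).
Qed.

Lemma rvar_neq0 : rvar C != 0.
Proof. by rewrite tofrac_eq0 polyX_eq0. Qed.

Lemma two_ratfun_neq0 : 2%:R != 0 :> ratfun C.
Proof. by have [] := two_half rconst_half. Qed.

Lemma K_polyE :
  map_mx (@tofrac _) (K_poly (s ^+ 2 - 1)) =
  K_mx (rvar C ^+ 2 - (rconst s ^+ 2 - 1)) (2%:R * rvar C).
Proof.
rewrite map_K_poly flip_span_K_mx; congr (K_mx (_ - _) _).
by rewrite /rconst polyCB polyC_exp rmorphB rmorphXn polyC1 rmorph1.
Qed.

Lemma vector_boundary_reflection : exists K : 'M[ratfun C]_4,
  [/\ K != 0, intertwines (twisted_yangian serre 0) s K,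
      forall K', intertwines (twisted_yangian serre 0) s K' ->
        exists c, K' = c *: K
    & reflection_equation K].
Proof.
exists (map_mx (@tofrac _) (K_poly (s ^+ 2 - 1))).
split; last exact: K_reflection.
- rewrite K_polyE.
  exact: (K_mx_neq0 _ (mulf_neq0 two_ratfun_neq0 rvar_neq0)).
- rewrite K_polyE; apply/intertwinesP; split=> [|b|b].
  + exact: K_mx_H2.
  + exact: K_mx_E.
  + rewrite !(tensor_twEE _ _ _ rconst_half); exact: K_mx_twE.
- move=> K' /intertwinesP[KH2 KE Ktw]; rewrite K_polyE.
  apply: (K_mx_unique (h := h) two_ratfun_neq0 rvar_neq0 KH2 KE).
  have twE w := tensor_twEE w (rconst s) true rconst_half.
  exact: (etrans (f_equal (mulmx^~ K') (esym (twE _)))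
    (etrans (Ktw true) (f_equal (mulmx K') (twE _)))).
Qed.

End TwistedYangian.

Theorem proposition5p6 (R : realType) (s : R[i]) (serre : Y R[i] -> Prop)
    (serreP : serre_compatible serre) :
  exists K : 'M[ratfun R[i]]_4,
    [/\ K != 0,
        intertwines (twisted_yangian serre 0) s K,
        forall K' : 'M[ratfun R[i]]_4,
          intertwines (twisted_yangian serre 0) s K' ->
          exists c : ratfun R[i], K' = c *: K
      & reflection_equation K].
Proof.
apply: vector_boundary_reflection => //.
by rewrite Num.Theory.pnatr_eq0.
Qed.
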